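(* Let $f:\mathbb{R}^d\to\mathbb{R}$ have a gradient that is $L$-Lipschitz continuous at all points of interest and a Hessian that is $M$-Lipschitz continuous, and let $f$ be uniformly bounded below by $\bar f$. Let $\delta\in(0,1)$. Run the algorithm described in the context with $\alpha_k=\epsilon_H$ at every negative curvature step, so that one can take $\alpha=\epsilon_H$, and suppose that at all iterations $k$ the inexact oracles satisfy $$\|g_k-\nabla f(x_k)\|\le \tfrac13\max\{\epsilon_g,\|g_k\|\},\qquad \|H_k-\nabla^2 f(x_k)\|\le \tfrac29\epsilon_H,\qquad |\hat\lambda_k-\lambda_{\min}(H_k)|\le \tfrac19\epsilon_H .$$ Then with probability at least $1-\delta$ the algorithm terminates within at most $n$ iterations, where $$n = 6\,(f(x_0)-\bar f)\left(\max\left\{\frac{2L}{\epsilon_g^2},\frac{3M^2}{\epsilon_H^3}\right\}\right)+\tilde O\left(\frac{\max\{L\epsilon_H,\,M\epsilon_g\}\,M\epsilon_g}{\epsilon_H^4}\right),$$ and where, when $M\epsilon_g<L\epsilon_H$, the last term is dominated by the first term up to a logarithmic factor and constants involving $L$, $M$ and $f(x_0)-\bar f$.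
   Context: Norms are the Euclidean norm for vectors and the spectral norm for matrices; Lipschitz continuity of the Hessian is measured in the spectral norm. Meaning of $\tilde O$: here $\tilde O(Q)$ stands for a quantity bounded by $c\,\Lambda\,Q$ with $c$ a universal constant and $\Lambda$ the logarithmic factor $\Lambda=\max\{\log(1/\delta),\log(4(f(x_0)-\bar f)/R_\epsilon),2\log(2BC),1\}$, where $R_\epsilon=\min\left(\frac{\epsilon_g^2}{6L},\frac{2\epsilon_H^3}{9M^2}\right)$, $B=1+\frac{18\alpha L}{M\epsilon_g}$, $C=2304\frac{M^2\alpha^2\epsilon_g^2}{\epsilon_H^6}$, and $\alpha=\epsilon_H$. Oracles: at the iterate $x_k$ the algorithm receives an approximate gradient $g_k\in\mathbb{R}^d$ and, if requested, a symmetric approximate Hessian $H_k\in\mathbb{R}^{d\times d}$ together with a unit vector $\hat p_k$ (approximate minimum eigenvector of $H_k$) and the value $\hat\lambda_k:=\hat p_k^T H_k\hat p_k$. The oracle outputs may themselves be random. Algorithm: inputs are tolerances $\epsilon_g,\epsilon_H>0$, Lipschitz constants $L,M$, an upper bound $\alpha\in[\epsilon_H,L]$ on negative curvature stepsizes, and an initial point $x_0\in\mathbb{R}^d$. For $k=0,1,2,\dots$: (i) if $\|g_k\|>\epsilon_g$, set $x_{k+1}=x_k-\frac1L g_k$ (gradient step); (ii) else if $\hat\lambda_k<-\epsilon_H$, choose $\alpha_k\in[\epsilon_H,\min(\alpha,|\hat\lambda_k|)]$, then draw $\sigma_k\in\{+1,-1\}$ with probability $\frac12$ each, and set $x_{k+1}=x_k+\frac{2\alpha_k}{M}\sigma_k\hat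 p_k$ (negative curvature step); (iii) else terminate and return $x_k$. The draw $\sigma_k$ is independent of everything generated before it: all $\sigma_i$ with $i<k$, and all $x_i,g_i,H_i,\hat p_i,\hat\lambda_i,\alpha_i$ with $i\le k$. *)

(* Defs.v *)
From HB Require Import structures.
From mathcomp Require Import all_boot all_order all_algebra.
From mathcomp Require Import all_classical all_reals all_analysis.

Set Implicit Arguments.
Unset Strict Implicit.
Unset Printing Implicit Defensive.

Import Order.TTheory GRing.Theory Num.Theory.
Import numFieldNormedType.Exports.

Local Open Scope classical_set_scope.
Local Open Scope ring_scope.

(* Points of R^d are row vectors.  The norm that the library puts on matrices
   is the sup norm; it is used here only for its topology (differentiability,
   neighbourhoods).  All quantitative bounds use [enorm] and [spectral_norm]. *)
Section Euclidean.
Context {R : realType} {d : nat}.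
Implicit Types (x y v : 'rV[R]_d) (A : 'M[R]_d) (f : 'rV[R]_d -> R).

Definition enorm v : R := Num.sqrt (\sum_(i < d) v 0 i ^+ 2).

(* [v *m A^T] is the row form of the matrix-vector product A v. *)
Definition spectral_norm A : R :=
  sup [set enorm (v *m A^T) | v in [set v | enorm v <= 1]].

Definition lambda_min A : R := inf [set a : R | eigenvalue A a].

Definition grad f x : 'rV[R]_d := \row_(i < d) 'D_(delta_mx 0 i) f x.

Definition hess f x : 'M[R]_d := 'J (grad f) x.

Definition twice_differentiable f x : Prop :=
  (\forall y \near x, differentiable f y) /\ differentiable (grad f) x.

Definition gradient_lipschitz_on (D : set 'rV[R]_d) (L : R) f : Prop :=
  forall x y, D x -> D y -> enorm (grad f x - grad f y) <= L * enorm (x - y).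

Definition hessian_lipschitz_on (D : set 'rV[R]_d) (M : R) f : Prop :=
  forall x y, D x -> D y ->
    spectral_norm (hess f x - hess f y) <= M * enorm (x - y).

End Euclidean.

(* All quantities generated by the algorithm, as functions of the outcome.
   They are indexed by every k : nat so as to be total; entries that the
   algorithm does not use (an unrequested Hessian, anything after termination)
   are not constrained below, apart from measurability. *)
Record trajectory (R : realType) (d : nat) (T : Type) := Trajectory {
  iterate : nat -> T -> 'rV[R]_d;
  grad_oracle : nat -> T -> 'rV[R]_d;
  hess_oracle : nat -> T -> 'M[R]_d;
  direction : nat -> T -> 'rV[R]_d;
  stepsize : nat -> T -> R;
  coin : nat -> T -> R }.

Section Algorithm.
Context {R : realType} {d : nat} {disp : measure_display}
  {T : measurableType disp}.
Variables (P : probability T R) (eg eH L M alpha : R) (t : trajectory R d T).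
Implicit Types (k : nat) (w : T).

Definition lambda_hat k w : R :=
  (direction t k w *m hess_oracle t k w *m (direction t k w)^T) 0 0.

Definition takes_gradient_step k w : Prop := eg < enorm (grad_oracle t k w).

Definition takes_curvature_step k w : Prop :=
  enorm (grad_oracle t k w) <= eg /\ lambda_hat k w < - eH.

Definition stops k w : Prop :=
  enorm (grad_oracle t k w) <= eg /\ - eH <= lambda_hat k w.

Definition reaches k w : Prop := forall j, (j < k)%N -> ~ stops j w.

Definition requests_hessian k w : Prop :=
  reaches k w /\ enorm (grad_oracle t k w) <= eg.

(* The algorithm returns the k-th iterate, having taken exactly k steps. *)
Definition terminates_at k w : Prop := reaches k w /\ stops k w.

Definition terminates_within (n : R) : set T :=
  [set w | exists k, k%:R <= n /\ terminates_at k w].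

(* The scalar random variables generated before the k-th coin is drawn. *)
Inductive observed k : (T -> R) -> Prop :=
| Obs_iterate i j of (i <= k)%N : observed k (fun w => iterate t i w 0 j)
| Obs_gradient i j of (i <= k)%N : observed k (fun w => grad_oracle t i w 0 j)
| Obs_hessian i j l of (i <= k)%N :
    observed k (fun w => hess_oracle t i w j l)
| Obs_direction i j of (i <= k)%N : observed k (fun w => direction t i w 0 j)
| Obs_lambda_hat i of (i <= k)%N : observed k (lambda_hat i)
| Obs_stepsize i of (i <= k)%N : observed k (stepsize t i)
| Obs_coin i of (i < k)%N : observed k (coin t i).

Definition history k : set (set T) :=
  <<s [set A | exists X (B : set R),
         [/\ observed k X, measurable B & A = X @^-1` B] ]>>.

Record algorithm_run (x0 : 'rV[R]_d) : Prop := AlgorithmRun {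
  run_alpha : eH <= alpha <= L;
  run_measurable : forall k X, observed k X -> measurable_fun setT X;
  run_start : forall w, iterate t 0 w = x0;
  run_hessian_sym : forall k w, requests_hessian k w ->
    (hess_oracle t k w)^T = hess_oracle t k w;
  run_direction_unit : forall k w, requests_hessian k w ->
    enorm (direction t k w) = 1;
  run_gradient_step : forall k w, reaches k w -> takes_gradient_step k w ->
    iterate t k.+1 w = iterate t k w - L^-1 *: grad_oracle t k w;
  run_stepsize : forall k w, reaches k w -> takes_curvature_step k w ->
    eH <= stepsize t k w <= Num.min alpha `|lambda_hat k w|;
  run_curvature_step : forall k w, reaches k w -> takes_curvature_step k w ->
    iterate t k.+1 w = iterate t k w
      + (2 * stepsize t k w / M * coin t k w) *: direction t k w;
  run_coin_values : forall k w, coin t k w = 1 \/ coin t k w = -1;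
  run_coin_plus : forall k, P (coin t k @^-1` [set 1]) = (2^-1)%:E;
  run_coin_minus : forall k, P (coin t k @^-1` [set -1]) = (2^-1)%:E;
  run_coin_independent : forall k (A : set T) (B : set R),
    history k A -> measurable B ->
    P (A `&` coin t k @^-1` B) = (P A * P (coin t k @^-1` B))%E }.

Record accurate_oracles (f : 'rV[R]_d -> R) : Prop := AccurateOracles {
  accurate_gradient : forall k w, reaches k w ->
    enorm (grad_oracle t k w - grad f (iterate t k w))
      <= 3^-1 * Num.max eg (enorm (grad_oracle t k w));
  accurate_hessian : forall k w, requests_hessian k w ->
    spectral_norm (hess_oracle t k w - hess f (iterate t k w)) <= 2 / 9 * eH;
  accurate_eigenvalue : forall k w, requests_hessian k w ->
    `|lambda_hat k w - lambda_min (hess_oracle t k w)| <= 9^-1 * eH }.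

(* "Points of interest": the starting point together with every segment joining
   two consecutive iterates; [reaches k.+1 w] says that a step is taken from
   the k-th iterate. *)
Definition visits_only (D : set 'rV[R]_d) : Prop :=
  (forall w, D (iterate t 0 w)) /\
  (forall k w (s : R), reaches k.+1 w -> 0 <= s <= 1 ->
     D (iterate t k w + s *: (iterate t k.+1 w - iterate t k w))).

End Algorithm.

Section LogFactor.
Context {R : realType}.
(* [gap] stands for f(x0) - fbar *)
Variables (eg eH L M alpha gap delta : R).

Definition R_eps : R :=
  Num.min (eg ^+ 2 / (6 * L)) (2 * eH ^+ 3 / (9 * M ^+ 2)).

Definition B_const : R := 1 + 18 * alpha * L / (M * eg).

Definition C_const : R :=
  2304 * (M ^+ 2 * alpha ^+ 2 * eg ^+ 2 / eH ^+ 6).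

(* For gap = 0 the second logarithm should be -oo and thus irrelevant to the
   maximum; the library value [ln 0 = 0] has the same effect. *)
Definition log_factor : R :=
  Num.max (ln (1 / delta))
    (Num.max (ln (4 * gap / R_eps))
      (Num.max (2 * ln (2 * B_const * C_const)) 1)).

End LogFactor.

(* Main.v *)
(* A gradient step decreases f by at least eg^2 / (6 L).  A curvature step
   decreases f by at least a = 2 eH^3 / (9 M^2) up to the term
   Y = (2 eH / M) sigma <grad f x, p>, which is a fair coin flip of size at most
   b = 8 eH eg / (3 M), because |grad f x| <= 4/3 eg there.  So after N steps
   f has dropped by N min(eg^2 / (6 L), a / 2) - W, where W sums Y - a / 2 over
   the curvature steps.  If b <= a / 2 then W <= 0 and the number of steps is
   bounded surely.  Otherwise cosh y <= exp (2 y^2) for |y| <= 1/2 shows that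
   exp (theta W) is a supermartingale for theta = a / (4 b^2), and Markov's
   inequality bounds the probability of taking N steps. *)
Require Import Defs.
From HB Require Import structures.
From mathcomp Require Import all_boot all_order all_algebra.
From mathcomp Require Import all_classical all_reals all_analysis.
From mathcomp Require Import measurable_realfun ring lra.

Set Implicit Arguments.
Unset Strict Implicit.
Unset Printing Implicit Defensive.

Import Order.TTheory GRing.Theory Num.Theory.
Import numFieldNormedType.Exports.

Local Open Scope classical_set_scope.
Local Open Scope ring_scope.

(** * Euclidean geometry and Taylor bounds *)

Section EuclideanSpace.
Context {R : realType} {d : nat}.
Implicit Types (u v p x : 'rV[R]_d) (A B : 'M[R]_d).

Definition dot u v : R := \sum_(i < d) u 0 i * v 0 i.

Lemma dotE u v : (u *m v^T) 0 0 = dot u v.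
Proof. by rewrite mxE; apply: eq_bigr => i _; rewrite mxE. Qed.

Lemma dotC u v : dot u v = dot v u.
Proof. by apply: eq_bigr => i _; rewrite mulrC. Qed.

Lemma dotBl u v p : dot (u - v) p = dot u p - dot v p.
Proof. by rewrite -!dotE mulmxBl !mxE. Qed.

Lemma dotZl c u v : dot (c *: u) v = c * dot u v.
Proof. by rewrite /dot mulr_sumr; apply: eq_bigr => i _; rewrite mxE mulrA. Qed.

Lemma dotZr c u v : dot u (c *: v) = c * dot u v.
Proof. by rewrite dotC dotZl dotC. Qed.

Lemma enorm_ge0 u : 0 <= enorm u. Proof. exact: sqrtr_ge0. Qed.

Lemma sqr_enorm u : enorm u ^+ 2 = dot u u.
Proof.
rewrite sqr_sqrtr; first by apply: eq_bigr => i _; rewrite expr2.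
by apply: sumr_ge0 => i _; rewrite sqr_ge0.
Qed.

Lemma enormZ c u : enorm (c *: u) = `|c| * enorm u.
Proof.
apply/eqP; rewrite -(@eqrXn2 _ 2) ?mulr_ge0 ?enorm_ge0//.
by rewrite exprMn sqr_enorm dotZl dotZr -sqr_enorm real_normK ?num_real// mulrA.
Qed.

Lemma enorm_eq0 u : enorm u = 0 -> u = 0.
Proof.
move=> u0; have /eqP : enorm u ^+ 2 = 0 by rewrite u0 expr0n.
rewrite sqr_enorm psumr_eq0; last by move=> i _; rewrite -expr2 sqr_ge0.
move=> /allP h; apply/rowP => i; rewrite mxE.
by have := h i (mem_index_enum _); rewrite mulf_eq0 orbb => /eqP.
Qed.

(** Cauchy-Schwarz: expand the squared norm of [enorm v *: u - enorm u *: v], which is nonnegative,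
    and divide by [2 * enorm u * enorm v]. *)
Lemma dot_le u v : dot u v <= enorm u * enorm v.
Proof.
have [u0|un0] := eqVneq (enorm u) 0.
  by rewrite u0 mul0r (enorm_eq0 u0) /dot big1// => i _; rewrite mxE mul0r.
have [v0|vn0] := eqVneq (enorm v) 0.
  by rewrite v0 mulr0 (enorm_eq0 v0) /dot big1// => i _; rewrite mxE mulr0.
have uv0 : 0 < enorm u * enorm v by rewrite mulr_gt0// lt0r enorm_ge0 ?un0 ?vn0.
have := sqr_ge0 (enorm (enorm v *: u - enorm u *: v)).
rewrite sqr_enorm dotBl !(dotC _ (_ - _)) !dotBl !dotZl !dotZr -!sqr_enorm.
rewrite (dotC v u) => h; rewrite -subr_ge0 -(pmulr_rge0 _ uv0).
move: h; lra.
Qed.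

Lemma normr_dot_le u v : `|dot u v| <= enorm u * enorm v.
Proof.
rewrite ler_norml dot_le andbT lerNl.
by have := dot_le (-1 *: u) v; rewrite dotZl enormZ normrN1 mul1r mulN1r.
Qed.

Lemma enorm_coord u i : `|u 0 i| <= enorm u.
Proof.
rewrite -sqrtr_sqr ler_wsqrtr// (bigD1 i)//= lerDl.
by apply: sumr_ge0 => j _; rewrite sqr_ge0.
Qed.

Definition quad A v : R := (v *m A *m v^T) 0 0.

Lemma quadZ A c v : quad A (c *: v) = c ^+ 2 * quad A v.
Proof. by rewrite /quad linearZ/= -!scalemxAl -scalemxAr !mxE; ring. Qed.

Lemma quadB A B v : quad (A - B) v = quad A v - quad B v.
Proof. by rewrite /quad mulmxBr mulmxBl !mxE. Qed.

(** A scalar equals its transpose. This links the form [p *m H *m p^T] of [lambda_hat] to the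
    convention [v *m A^T] of [spectral_norm]. *)
Lemma quadE A v : quad A v = dot (v *m A^T) v.
Proof.
rewrite -dotE /quad -[in RHS]mulmxA mxE [RHS]mxE.
rewrite [LHS](_ : _ = ((v *m A) *m v^T)^T 0 0); last by rewrite mxE [RHS]mxE.
by rewrite trmx_mul trmxK mxE trmx_mul.
Qed.

(** Cauchy-Schwarz row by row. It shows that the supremum defining [spectral_norm] is taken over a
    bounded set. *)
Lemma enorm_mulmx_bounded A v : enorm v <= 1 ->
  enorm (v *m A^T) <= Num.sqrt (\sum_(i < d) enorm (row i A) ^+ 2).
Proof.
move=> v1; apply: ler_wsqrtr; apply: ler_sum => i _.
have -> : (v *m A^T) 0 i = dot v (row i A).
  by rewrite mxE; apply: eq_bigr => j _; rewrite !mxE.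
rewrite -real_normK ?num_real// ler_sqr ?nnegrE ?enorm_ge0//.
by rewrite (le_trans (normr_dot_le _ _))// ler_piMl ?enorm_ge0.
Qed.

Lemma spectral_norm_ge A p : enorm p = 1 -> `|quad A p| <= spectral_norm A.
Proof.
move=> p1; rewrite quadE (le_trans (normr_dot_le _ _))// p1 mulr1.
apply: ub_le_sup; last by exists p => //=; rewrite p1.
exists (Num.sqrt (\sum_(i < d) enorm (row i A) ^+ 2)) => _ [v v1 <-].
exact: enorm_mulmx_bounded.
Qed.

Lemma normr_quad_le A v : `|quad A v| <= spectral_norm A * enorm v ^+ 2.
Proof.
have [v0|vn0] := eqVneq (enorm v) 0.
  rewrite v0 expr0n mulr0 (enorm_eq0 v0).
  by rewrite -[X in quad A X](scale0r 0) quadZ expr0n mul0r normr0.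
rewrite -[X in quad A X](scalerK vn0) scalerA mulrC -scalerA quadZ normrM.
rewrite ger0_norm ?sqr_ge0// mulrC ler_wpM2r ?sqr_ge0//.
apply: spectral_norm_ge; rewrite enormZ ger0_norm ?invr_ge0 ?enorm_ge0//.
exact: mulVf.
Qed.

End EuclideanSpace.

(** * Taylor upper bounds along a segment *)

Section TaylorBounds.
Context {R : realType} {d : nat}.
Variables (f : 'rV[R]_d -> R) (x v : 'rV[R]_d).

(** The difference quotient of the restriction to the line and that of [F] in direction [v] are the
    same function of [h]. *)
Lemma is_derive_line (V : normedModType R) (F : 'rV[R]_d -> V) (s : R) :
  differentiable F (x + s *: v) ->
  is_derive s 1 (fun r : R => F (x + r *: v)) ('D_v F (x + s *: v)).
Proof.
move=> dF.
have E : (fun h : R => h^-1 *: ((fun r : R => F (x + r *: v)) (h *: 1 + s)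
            - F (x + s *: v))) =
         (fun h => h^-1 *: (F (h *: v + (x + s *: v)) - F (x + s *: v))).
  apply/funext => h; congr (_ *: (F _ - _)).
  by rewrite [h *: 1]mulr1 scalerDl addrCA.
have dFv : derivable F (x + s *: v) v by exact: diff_derivable.
by split; [rewrite /derivable /= E|rewrite /derive /= E].
Qed.

Lemma derive_grad y : differentiable f y -> 'D_v f y = dot (grad f y) v.
Proof.
move=> df; rewrite deriveE// [in LHS](row_sum_delta v) linear_sum /dot.
by apply: eq_bigr => i _; rewrite linearZ/= mxE deriveE// mulrC.
Qed.

Lemma derive_dot_grad y : differentiable (grad f) y ->
  differentiable (fun z => dot (grad f z) v) y /\
  'D_v (fun z => dot (grad f z) v) y = quad (hess f y) v.
Proof.
move=> dg.
have dc i : differentiable (fun z => grad f z 0 i) y.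
  exact: (differentiable_comp dg (differentiable_coord _ _ _)).
have E : (fun z => dot (grad f z) v) =
    \sum_(i < d) (fun z => v 0 i *: (grad f z 0 i)).
  by apply/funext => z; rewrite fct_sumE; apply: eq_bigr => i _; rewrite mulrC.
have dci i : differentiable (fun z => v 0 i *: (grad f z 0 i)) y.
  exact: differentiableZ.
split; first by rewrite E; exact: differentiable_sum.
rewrite E derive_sum; last by move=> i; exact: diff_derivable.
have := @deriveEjacobian _ _ _ (grad f) y v dg.
rewrite derive_mx; last exact: diff_derivable.
rewrite /quad => <-; rewrite dotE; apply: eq_bigr => i _.
rewrite deriveZ; last exact: diff_derivable.
by rewrite mxE mulrC.
Qed.

(** One computation for all the Taylor arguments below: each subtracts a polynomial model of degree
    at most 3 without constant term. *)
Lemma is_derive_sub_cubic (F : R -> R) (dF a b c s : R) :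
  is_derive s 1 F dF ->
  is_derive s 1 (fun r => F r - (a * r + b * r ^+ 2 + c * r ^+ 3))
    (dF - (a + 2 * b * s + 3 * c * s ^+ 2)).
Proof.
move=> dFs.
rewrite (_ : (fun r => _) =
    F - (a *: id + b *: (id : R -> R) ^+ 2 + c *: (id : R -> R) ^+ 3)).
  have did := is_derive_id s (1 : R).
  have dpoly := is_deriveD (is_deriveD (is_deriveZ a did)
    (is_deriveZ b (is_deriveX 2 did))) (is_deriveZ c (is_deriveX 3 did)).
  apply: (is_derive_eq (is_deriveB dFs dpoly)).
  rewrite /GRing.scale/= /GRing.scale/=.
  ring.
by apply/funext => r; rewrite !fctE.
Qed.

Lemma derive_le0_le (h h' : R -> R) (b : R) : 0 <= b ->
  (forall s, 0 <= s <= b -> is_derive s 1 h (h' s)) ->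
  (forall s, 0 <= s <= b -> h' s <= 0) -> h b <= h 0.
Proof.
move=> b0 dh h'0.
apply: (@ler0_derive1_le_cc _ h 0 b) => //; rewrite ?in_itv/= ?lexx ?b0//.
- move=> s /[!in_itv]/= /andP[s0 sb].
  by have [] : is_derive s 1 h (h' s) by apply: dh; rewrite !ltW.
- move=> s /[!in_itv]/= /andP[s0 sb]; have sI : 0 <= s <= b by rewrite !ltW.
  have dhs := dh _ sI.
  by rewrite derive1E (@derive_val _ _ _ _ _ _ _ dhs) h'0.
- apply: derivable_within_continuous => s /[!in_itv]/= sI.
  by have [] := dh _ sI.
Qed.

Hypothesis f_diff : forall s : R, 0 <= s <= 1 -> differentiable f (x + s *: v).

Let f_line (s : R) : 0 <= s <= 1 ->
  is_derive s 1 (fun r : R => f (x + r *: v)) (dot (grad f (x + s *: v)) v).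
Proof.
by move=> /f_diff df; rewrite -derive_grad//; exact: is_derive_line.
Qed.

(** Along the segment, [f] minus its quadratic model has nonpositive derivative, by Cauchy-Schwarz
    and the Lipschitz bound; compare its values at 0 and 1. *)
Lemma gradient_taylor_le (L : R) :
  (forall s : R, 0 <= s <= 1 ->
     enorm (grad f (x + s *: v) - grad f x) <= L * enorm (s *: v)) ->
  f (x + v) <= f x + dot (grad f x) v + L / 2 * enorm v ^+ 2.
Proof.
move=> lip.
set g := dot (grad f x) v; set n := enorm v ^+ 2.
pose h s : R := f (x + s *: v) - (g * s + L / 2 * n * s ^+ 2 + 0 * s ^+ 3).
suff : h 1 <= h 0.
  by rewrite /h scale1r scale0r addr0 !expr1n !expr0n/=; lra.
pose h' s : R := dot (grad f (x + s *: v)) v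
  - (g + 2 * (L / 2 * n) * s + 3 * 0 * s ^+ 2).
apply: (@derive_le0_le h h') => // s sI.
  exact: is_derive_sub_cubic (f_line sI).
suff : dot (grad f (x + s *: v) - grad f x) v <= L * n * s.
  by rewrite dotBl /h' -/g; move: (dot _ _) (g) => g1 g2; lra.
rewrite (le_trans (dot_le _ _))//.
have := lip _ sI; rewrite enormZ ger0_norm; last by case/andP: sI.
by move=> /(ler_wpM2r (enorm_ge0 v)); rewrite /n; lra.
Qed.

Hypothesis grad_diff : forall s : R, 0 <= s <= 1 ->
  differentiable (grad f) (x + s *: v).

(** The same comparison twice: first for the slope of [f] along the segment, whose derivative is a
    quadratic form of the Hessian, then for [f] itself with a cubic model. *)
Lemma hessian_taylor_le (M : R) :
  (forall s : R, 0 <= s <= 1 ->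
     spectral_norm (hess f (x + s *: v) - hess f x) <= M * enorm (s *: v)) ->
  f (x + v) <= f x + dot (grad f x) v + quad (hess f x) v / 2
               + M / 6 * enorm v ^+ 3.
Proof.
move=> lip.
set g := dot (grad f x) v; set q := quad (hess f x) v.
set n := enorm v ^+ 3.
have grad_le (s : R) : 0 <= s <= 1 ->
    dot (grad f (x + s *: v)) v <= g + s * q + M / 2 * n * s ^+ 2.
  move=> /andP[s0 s1].
  pose h r : R := dot (grad f (x + r *: v)) v 
      - (q * r + M / 2 * n * r ^+ 2 + 0 * r ^+ 3).
  suff : h s <= h 0.
    by rewrite /h scale0r addr0 !expr0n/= -/g;
      move: (dot _ _) (g) (q) => g1 g2 q1; lra.
  pose h' r : R := quad (hess f (x + r *: v)) v
    - (q + 2 * (M / 2 * n) * r + 3 * 0 * r ^+ 2).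
  apply: (@derive_le0_le h h') => // r /andP[r0 rs].
    have rI : 0 <= r <= 1 by rewrite r0 (le_trans rs).
    have [dd De] := derive_dot_grad (grad_diff rI).
    have dl := is_derive_line dd; rewrite De in dl.
    exact: is_derive_sub_cubic dl.
  have rI : 0 <= r <= 1 by rewrite r0 (le_trans rs).
  suff : quad (hess f (x + r *: v) - hess f x) v <= M * n * r.
    have sub_le (a b : R) : a - b <= M * n * r ->
      a - (b + 2 * (M / 2 * n) * r + 3 * 0 * r ^+ 2) <= 0 by lra.
    by rewrite quadB; exact: sub_le.
  rewrite (le_trans (ler_norm _))// (le_trans (normr_quad_le _ _))//.
  have := lip _ rI; rewrite enormZ ger0_norm//.
  by move=> /(ler_wpM2r (sqr_ge0 (enorm v))); rewrite /n; lra.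
pose h s : R := f (x + s *: v)
  - (g * s + q / 2 * s ^+ 2 + M / 6 * n * s ^+ 3).
suff : h 1 <= h 0.
  rewrite /h scale1r scale0r addr0 !expr1n !expr0n/=.
  by move: (f (x + v)) (f x) (g) (q) => f1 f2 g1 q1; lra.
pose h' s : R := dot (grad f (x + s *: v)) v
  - (g + 2 * (q / 2) * s + 3 * (M / 6 * n) * s ^+ 2).
apply: (@derive_le0_le h h') => // s sI.
  exact: is_derive_sub_cubic (f_line sI).
by have := grad_le _ sI; rewrite /h'; move: (dot _ _) (g) (q) => g1 g2 q1; lra.
Qed.

End TaylorBounds.

(** * Measurability, independence, exponential moments *)

Section RandomVectors.
Context {R : realType} {d : nat} {disp : measure_display}
  {T : measurableType disp}.
Implicit Types (X : T -> 'rV[R]_d).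

Lemma measurable_enorm X :
  (forall j, measurable_fun setT (fun w => X w 0 j)) ->
  measurable_fun setT (fun w => enorm (X w)).
Proof.
move=> mX; apply: (@measurableT_comp _ _ _ _ _ _ (@Num.sqrt R)).
  exact: (continuous_measurable_fun (@sqrt_continuous R)).
by apply: measurable_sum => i; exact: measurable_funX.
Qed.

Lemma enorm_le_sum (v : 'rV[R]_d) : enorm v <= \sum_(i < d) `|v 0 i|.
Proof.
have [->|vn0] := eqVneq (enorm v) 0; first by apply: sumr_ge0.
have v0 : 0 < enorm v by rewrite lt0r vn0 enorm_ge0.
rewrite -(ler_pM2l v0) -expr2 sqr_enorm mulr_sumr; apply: ler_sum => i _.
rewrite (le_trans (ler_norm _))// normrM ler_wpM2r//.
exact: enorm_coord.
Qed.

(* A Lipschitz function on D is recovered from its values on a countable dense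
   subset of D, so that D itself needs no measurability. *)
Lemma measurable_lipschitz_comp (D : set 'rV[R]_d) (h : 'rV[R]_d -> R) (L : R)
    (A : set T) X :
  0 <= L -> (forall x y, D x -> D y -> `|h x - h y| <= L * enorm (x - y)) ->
  (forall j, measurable_fun setT (fun w => X w 0 j)) ->
  (forall w, A w -> D (X w)) -> measurable_fun A (fun w => h (X w)).
Proof.
move=> L0 lip mX AD.
pose near_pts (q : 'rV[rat]_d * nat) : set 'rV[R]_d :=
  [set y | D y /\ forall j, `|ratr (q.1 0 j) - y 0 j| < q.2.+1%:R^-1].
(* A point of [D] in the box given by [q], or the default 0 when the box misses [D]; the condition
   [near_pts q (Y q)] rules the latter case out. *)
pose Y q := xget 0 (near_pts q).
have YP q y : near_pts q y -> near_pts q (Y q).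
  by move=> qy; exact: (xgetI 0 qy).
have dense x e : D x -> 0 < e ->
    exists q, near_pts q (Y q) /\ enorm (x - Y q) < e.
  move=> Dx e0.
  (* Each coordinate of [x] and of [Y q] is within 1/(n+1) of the same rational, so their distance
     is at most 2d/(n+1) < e. *)
  pose n := Num.truncn (2 * d%:R / e).
  have nlt : 2 * d%:R / e < n.+1%:R by exact: Num.Theory.truncnS_gt.
  have n0 : 0 < (n.+1%:R)^-1 :> R by rewrite invr_gt0.
  have qP j : {q : rat | `|ratr q - x 0 j| < n.+1%:R^-1}.
    have lt_itv : x 0 j - n.+1%:R^-1 < x 0 j + n.+1%:R^-1.
      by rewrite ltrBlDr -addrA ltrDl addr_gt0.
    apply: cid; have [q] := rat_in_itvoo lt_itv; rewrite inE/= => /itvP qI.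
    by exists q; rewrite ltr_norml ltrBrDl (ltrBlDl _ (x 0 j)) !qI.
  exists (\row_j sval (qP j), n).
  have nY : near_pts (\row_j sval (qP j), n) (Y (\row_j sval (qP j), n)).
    apply: (YP _ x); split=> // j; rewrite mxE; exact: (svalP (qP j)).
  split=> //; rewrite (le_lt_trans (enorm_le_sum _))//.
  apply: (@le_lt_trans _ _ (\sum_(j < d) 2 * n.+1%:R^-1)).
    apply: ler_sum => j _; rewrite !mxE.
    have := svalP (qP j); have := nY.2 j; rewrite mxE /=.
    move: (n.+1%:R^-1) (Y _ 0 j) (ratr (sval (qP j))) => r y q.
    rewrite !ltr_norml => /andP[a b].
    by move=> /andP[a' b']; rewrite ler_norml; apply/andP; split; lra.
  rewrite sumr_const card_ord -[ltLHS]mulr_natl mulrA (mulrC d%:R).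
  rewrite ltr_pdivrMr//.
  by rewrite [ltRHS]mulrC -ltr_pdivrMr.
move=> mA; apply: (measurability _ (RGenInftyO.measurableE R)) => //.
move=> /= _ [_ [c ->] <-].
rewrite [X in measurable X](_ : _ = \bigcup_(q in [set q | near_pts q (Y q)])
  (A `&` [set w | h (Y q) + L * enorm (X w - Y q) < c])); last first.
  apply/seteqP; split=> w /=.
    rewrite in_itv/= => -[Aw hc].
    (* With r the distance from [X w] to [Y q], the Lipschitz bound costs L r once and the added
       term another L r; this radius gives 2 L r < c - h (X w). *)
    have e0 : 0 < (c - h (X w)) / (2 * L + 1).
      by rewrite divr_gt0 ?subr_gt0//; lra.
    have [q [nq xq]] := dense _ _ (AD _ Aw) e0.
    exists q => //; split=> //=.
    have := lip _ _ (AD _ Aw) nq.1; rewrite distrC => /(le_trans (ler_norm _)).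
    move: xq; rewrite ltr_pdivlMr; last by lra.
    have := enorm_ge0 (X w - Y q).
    by move: (enorm _) (h (Y q)) (h (X w)) => *; nra.
  move=> [q nq [Aw /= hc]]; rewrite in_itv/=; split=> //.
  apply: le_lt_trans hc; rewrite -lerBlDl.
  exact: le_trans (ler_norm _) (lip _ _ (AD _ Aw) nq.1).
rewrite bigcup_mkcond; apply: countable_bigcupT_measurable => // q.
case: ifP => // _.
have mlt : measurable_fun A (fun w => h (Y q) + L * enorm (X w - Y q) < c).
  apply: measurable_fun_ltr => //; apply: measurable_funD => //.
  apply: measurable_funM => //; apply: measurable_funTS.
  apply: measurable_enorm => j.
  rewrite (_ : (fun w => _) = (fun w => X w 0 j - Y q 0 j)).
    exact: measurable_funB.
  by apply/funext => w; rewrite !mxE.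
have := mlt mA [set true]; rewrite preimage_true; exact.
Qed.

End RandomVectors.

Lemma restrict_notin {R : realType} {T : Type} (A : set T) (g : T -> R) w :
  ~ A w -> (g \_ A) w = 0.
Proof. by move=> Aw; rewrite patchE memNset. Qed.

(** * Integration over an event independent of a sigma-algebra *)

Section CoinFlips.
Local Open Scope ereal_scope.
Context {R : realType} {disp : measure_display} {T : measurableType disp}.
Variables (P : probability T R).

Lemma ge0_integral_mrestr (S : set T) (mS : measurable S) (V : T -> \bar R) :
  measurable_fun setT V -> (forall w, 0 <= V w) ->
  \int[mrestr P mS]_w V w = \int[P]_(w in S) V w.
Proof.
move=> mV V0.
rewrite (@ge0_negligible_integral _ _ _ _ _ (~` S))//; last 2 first.
  exact: measurableC.
  by rewrite /= /mrestr setICl measure0.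
rewrite setTD setCK; apply: eq_measure_integral => A mA AS.
by rewrite /= /mrestr setIidl.
Qed.

(** On the sigma-algebra generated by [G], the measures A -> P (A [&] S) and A -> P S * P A
    coincide. Both are carried there by pushing forward along the identity, and [V] is integrated
    against them. *)
Lemma integral_independent_event (G : set (set T)) (S : set T)
    (V : g_sigma_algebraType G -> \bar R) :
  (forall A, <<s G >> A -> measurable A) -> measurable S ->
  (forall A, <<s G >> A -> P (A `&` S) = P A * P S) ->
  measurable_fun setT V -> (forall w, 0 <= V w) ->
  \int[P]_(w in S) V w = P S * \int[P]_w V w.
Proof.
move=> sG mS indep mV V0.
pose id' : T -> g_sigma_algebraType G := id.
have mid : measurable_fun setT id' by move=> _ A /sG; rewrite setTI.
have mVT : measurable_fun setT (V : T -> \bar R).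
  exact: (measurableT_comp mV mid).
pose k : {nonneg R} := NngNum (fine_ge0 (measure_ge0 P S)).
have kE : k%:num%:E = P S by rewrite /= fineK// fin_num_measure.
rewrite -(ge0_integral_mrestr mS mVT V0).
rewrite -(@ge0_integral_pushforward _ _ _ _ _ _ mid (mrestr P mS) setT V)//.
rewrite (eq_measure_integral (mscale k (pushforward P id')))//.
  by rewrite ge0_integral_mscale// ge0_integral_pushforward//= kE.
move=> A mA _; rewrite /= /mscale /pushforward /mrestr /= kE muleC.
exact: indep.
Qed.

End CoinFlips.

(** From exp y <= 1 / (1 - y) the left side is at most 2 / (1 - x^2), which is at most 2 (1 + 2 x^2)
    when x^2 <= 1/4; then 1 + u <= exp u. *)
Lemma cosh_le {R : realType} (x : R) : `|x| <= 2^-1 ->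
  expR x + expR (- x) <= 2 * expR (2 * x ^+ 2).
Proof.
rewrite ler_norml => /andP[x1 x2].
have inv_le (y : R) : y < 1 -> expR y <= (1 - y)^-1.
  move=> y1; rewrite -[y in leLHS]opprK expRN.
  rewrite lef_pV2 ?posrE ?expR_gt0 ?subr_gt0//.
  exact: expR_ge1Dx.
have h1 : expR x <= (1 - x)^-1 by apply: inv_le; lra.
have h2 : expR (- x) <= (1 + x)^-1.
  by rewrite -[x in leRHS]opprK; apply: inv_le; lra.
have h3 := expR_ge1Dx (2 * x ^+ 2).
suff : (1 - x)^-1 + (1 + x)^-1 <= 2 * (1 + 2 * x ^+ 2) by lra.
have -> : (1 - x)^-1 + (1 + x)^-1 = 2 / (1 - x ^+ 2).
  by field; apply/and3P; split; apply: lt0r_neq0; nra.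
have x24 : x ^+ 2 <= 4^-1 by nra.
rewrite ler_pdivrMr; last by lra.
have := sqr_ge0 x; move: x24; move: (x ^+ 2) => y; nra.
Qed.

(** * Runs of the algorithm *)

Section Run.
Context {R : realType} {d : nat} {disp : measure_display}
  {T : measurableType disp}.
Variables (P : probability T R) (f : 'rV[R]_d -> R) (L M eg eH : R).
Variables (x0 : 'rV[R]_d) (D : set 'rV[R]_d) (t : trajectory R d T).
Hypotheses (eg0 : 0 < eg) (eH0 : 0 < eH) (L0 : 0 < L) (M0 : 0 < M).
Hypothesis f_smooth : forall x, D x -> twice_differentiable f x.
Hypothesis grad_lip : gradient_lipschitz_on D L f.
Hypothesis hess_lip : hessian_lipschitz_on D M f.
Hypothesis visits : visits_only eg eH t D.
Hypothesis run : algorithm_run P eg eH L M eH t x0.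
Hypothesis step_eH : forall k w, reaches eg eH t k w ->
  takes_curvature_step eg eH t k w -> stepsize t k w = eH.
Hypothesis accurate : accurate_oracles eg eH t f.

Local Notation reached := (reaches eg eH t).
Local Notation curved := (takes_curvature_step eg eH t).

(** * Decrease of the objective in one step *)

Lemma reachesS k w : reached k.+1 w <-> reached k w /\ ~ stops eg eH t k w.
Proof.
split=> [r|[r s] j]; last by rewrite ltnS leq_eqVlt => /orP[/eqP->|/r].
by split=> [j jk|]; apply: r => //; rewrite ltnS ltnW.
Qed.

Lemma reaches_curved k w : reached k w -> curved k w -> reached k.+1 w.
Proof.
by move=> r [_ c]; apply/reachesS; split=> // -[_]; rewrite leNgt c.
Qed.

Lemma visits_segment k w (s : R) : reached k.+1 w -> 0 <= s <= 1 ->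
  D (iterate t k w + s *: (iterate t k.+1 w - iterate t k w)).
Proof. exact: visits.2. Qed.

Lemma visits_iterate k w : reached k.+1 w -> D (iterate t k w).
Proof.
move=> r; rewrite -[iterate t k w]addr0.
rewrite -[X in _ + X](scale0r (iterate t k.+1 w - iterate t k w)).
by apply: visits_segment => //; rewrite lexx ler01.
Qed.

(** Since |g| > eg, the oracle error is at most |g| / 3, so <grad f x, g> >= 2/3 |g|^2. The step 1/L
    then gains 2/3 - 1/2 = 1/6 of |g|^2 / L. *)
Lemma gradient_step_decrease k w : reached k w ->
  takes_gradient_step eg t k w ->
  f (iterate t k.+1 w) <= f (iterate t k w) - eg ^+ 2 / (6 * L).
Proof.
move=> r gs; have rS : reached k.+1 w.
  by apply/reachesS; split=> // -[]; rewrite leNgt gs.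
have xE := run_gradient_step run r gs.
have acc := accurate_gradient accurate r.
set x := iterate t k w; set g := grad_oracle t k w in xE acc *.
rewrite max_r in acc; last exact: ltW.
have vE : iterate t k.+1 w - x = (- L^-1) *: g.
  by rewrite xE addrAC subrr add0r scaleNr.
have := @gradient_taylor_le _ _ f x (iterate t k.+1 w - x) _ L.
rewrite subrKC => /(_ _ _)/le_trans-> //.
- by move=> s sI; exact: nbhs_singleton (f_smooth (visits_segment rS sI)).1.
- move=> s sI; rewrite -[X in L * enorm X](addKr x) (addrC (- x)).
  exact: (grad_lip (visits_segment rS sI) (visits_iterate rS)).
rewrite vE dotZr enormZ normrN gtr0_norm ?invr_gt0//.
have gradg : 2 / 3 * enorm g ^+ 2 <= dot (grad f x) g.
  have := dot_le (g - grad f x) g; rewrite dotBl -sqr_enorm.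
  have := ler_wpM2r (enorm_ge0 g) acc; lra.
have g2 : eg ^+ 2 <= enorm g ^+ 2.
  by rewrite ler_sqr ?nnegrE ?enorm_ge0 ?ltW.
move: gradg g2; move: (dot _ _) (enorm g) (f x) => p n fx gradg g2.
rewrite -addrA lerD2l -subr_ge0.
rewrite [X in 0 <= X](_ : _ =
    (p - 2 / 3 * n ^+ 2 + (n ^+ 2 - eg ^+ 2) / 6) / L); last first.
  by field; exact: lt0r_neq0.
by rewrite divr_ge0 ?(ltW L0)// addr_ge0 ?divr_ge0 ?subr_ge0.
Qed.

Definition slope k w : R := dot (grad f (iterate t k w)) (direction t k w).

Lemma normr_slope_le k w : reached k w -> curved k w ->
  `|slope k w| <= 4 / 3 * eg.
Proof.
move=> r [gs cs]; have acc := accurate_gradient accurate r.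
rewrite max_l// in acc.
have p1 := run_direction_unit run (conj r gs).
have := normr_dot_le (grad_oracle t k w) (direction t k w).
have := normr_dot_le (grad_oracle t k w - grad f (iterate t k w))
  (direction t k w).
rewrite dotBl -/(slope k w) p1 !mulr1.
move: (dot _ _) (slope k w) => u v h1 h2.
have := ler_normB u (u - v); rewrite subKr => /le_trans; apply.
by move: acc gs h1 h2; move: (enorm _) (enorm _) `|u| `|u - v| => *; lra.
Qed.

(** The curvature of [f] along the direction is at most - eH + 2/9 eH = - 7/9 eH. For a step of
    length 2 eH / M the second and third order terms sum to (- 14/9 + 4/3) eH^3 / M^2. The first
    order term keeps its random sign. *)
Lemma curvature_step_decrease k w : reached k w -> curved k w ->
  f (iterate t k.+1 w) <= f (iterate t k w)
    + 2 * eH / M * coin t k w * slope k w - 2 * eH ^+ 3 / (9 * M ^+ 2).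
Proof.
move=> r cs; have rS := reaches_curved r cs.
have xE := run_curvature_step run r cs; rewrite (step_eH r cs) in xE.
have rq : requests_hessian eg eH t k w by split=> //; exact: cs.1.
have accH := accurate_hessian accurate rq.
have p1 := run_direction_unit run rq.
have lam : quad (hess_oracle t k w) (direction t k w) < - eH by exact: cs.2.
rewrite /slope.
set x := iterate t k w; set p := direction t k w in xE p1 lam *.
set c := 2 * eH / M * coin t k w in xE *.
have vE : iterate t k.+1 w - x = c *: p by rewrite xE addrAC subrr add0r.
have := @hessian_taylor_le _ _ f x (iterate t k.+1 w - x) _ _ M.
rewrite subrKC => /(_ _ _ _)/le_trans-> //.
- by move=> s sI; exact: nbhs_singleton (f_smooth (visits_segment rS sI)).1.
- by move=> s sI; exact: (f_smooth (visits_segment rS sI)).2.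
- move=> s sI; rewrite -[X in M * enorm X](addKr x) (addrC (- x)).
  exact: (hess_lip (visits_segment rS sI) (visits_iterate rS)).
have curv : quad (hess f x) p <= - (7 / 9 * eH).
  have := spectral_norm_ge (hess_oracle t k w - hess f x) p1.
  rewrite quadB ler_norml => /andP[+ _].
  move: accH lam; rewrite -/x.
  move: (quad _ _) (quad _ _) (spectral_norm _) => *; lra.
have c2 : c ^+ 2 = 4 * eH ^+ 2 / M ^+ 2.
  rewrite /c; have [->|->] := run_coin_values run k w;
  by field; exact: lt0r_neq0.
have nc : `|c| = 2 * eH / M.
  rewrite /c normrM; have [->|->] := run_coin_values run k w;
  by rewrite ?normrN normr1 mulr1 gtr0_norm// divr_gt0// mulr_gt0.
rewrite vE dotZr quadZ enormZ p1 mulr1 c2 nc.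
move: curv; move: (quad _ _) (c * _) (f x) => q s fx curv.
rewrite -!addrA !lerD2l -subr_ge0.
rewrite [X in 0 <= X](_ : _ =
    2 * eH ^+ 2 / M ^+ 2 * (- (7 / 9 * eH) - q)); last first.
  by field; exact: lt0r_neq0.
by apply: mulr_ge0; rewrite ?subr_ge0// divr_ge0 ?sqr_ge0// mulr_ge0 ?sqr_ge0.
Qed.

(** * Measurability with respect to the history before a coin *)

Definition history_events k : set (set T) :=
  [set A | exists X (B : set R),
     [/\ observed t k X, measurable B & A = X @^-1` B]].

(** [hist k] is the sample space with the sigma-algebra [history t k], so [known] and [known_fun]
    mean determined by what precedes the k-th coin. *)
Local Notation hist k := (g_sigma_algebraType (history_events k)).
Local Notation known k A := (@measurable _ (hist k) A).
Local Notation known_fun k A V := (@measurable_fun _ _ (hist k) _ A V).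

Lemma observed_measurable k (X : T -> R) :
  observed t k X -> known_fun k setT X.
Proof.
by move=> oX _ B mB; rewrite setTI; apply: sub_gen_smallest; exists X, B.
Qed.

Lemma history_measurable k (A : set T) : history t k A -> measurable A.
Proof.
apply: smallest_sub; first exact: sigma_algebra_measurable.
move=> _ [X [B [oX mB ->]]]; rewrite -[X in measurable X]setTI.
exact: (run_measurable run oX).
Qed.

Lemma history_measurable_fun k (d' : measure_display) (U : measurableType d')
    (V : T -> U) :
  known_fun k setT V -> measurable_fun setT V.
Proof. by move=> mV _ B mB; apply: (@history_measurable k); exact: mV. Qed.

Lemma small_gradient_measurable i k : (i <= k)%N ->
  known k [set w | enorm (grad_oracle t i w) <= eg].
Proof.
move=> ik.
have mg : known_fun k setT (fun w => enorm (grad_oracle t i w)).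
  apply: measurable_enorm => j.
  exact: observed_measurable (Obs_gradient t j ik).
have := measurable_fun_ler mg (measurable_cst eg).
by move=> /(_ measurableT [set true] I); rewrite setTI.
Qed.

Lemma stops_measurable i k : (i <= k)%N ->
  known k [set w | stops eg eH t i w].
Proof.
move=> ik; apply: measurableI; first exact: small_gradient_measurable.
have ml := observed_measurable (Obs_lambda_hat t ik).
have := measurable_fun_ler (measurable_cst (- eH)) ml.
by move=> /(_ measurableT [set true] I); rewrite setTI.
Qed.

Lemma curved_measurable i k : (i <= k)%N -> known k [set w | curved i w].
Proof.
move=> ik; apply: measurableI; first exact: small_gradient_measurable.
have ml := observed_measurable (Obs_lambda_hat t ik).
have := measurable_fun_ltr ml (measurable_cst (- eH)).
by move=> /(_ measurableT [set true] I); rewrite setTI.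
Qed.

(** The range extends to [k.+1] because reaching step [i] depends only on the stopping tests before
    [i]. *)
Lemma reaches_measurable i k : (i <= k.+1)%N ->
  known k [set w | reached i w].
Proof.
elim: i => [_|i IH ik].
  by rewrite (_ : [set w | _] = setT)//; apply/seteqP; split=> // w _ j.
rewrite (_ : [set w | _] =
    [set w | reached i w] `\` [set w | stops eg eH t i w]).
  by apply: measurableD; [apply: IH; exact: ltnW|exact: stops_measurable].
by apply/seteqP; split=> w /= /reachesS.
Qed.

Definition curvature_event k : set T := [set w | reached k w /\ curved k w].

Lemma curvature_event_measurable i k : (i <= k)%N ->
  known k (curvature_event i).
Proof.
move=> ik; apply: measurableI; last exact: curved_measurable.
by apply: reaches_measurable; exact: leqW.
Qed.

(** On the curvature event the iterate lies in [D], where each coordinate of the gradient is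
    L-Lipschitz; hence measurability is claimed on that event. *)
Lemma slope_measurable i k : (i <= k)%N ->
  known_fun k (curvature_event i) (slope i).
Proof.
move=> ik; apply: measurable_sum => j; apply: measurable_funM.
  apply: (@measurable_lipschitz_comp _ _ _ (hist k) D
    (fun x : 'rV[R]_d => grad f x 0 j) L _ (iterate t i)) => //.
  - exact: ltW.
  - move=> x y Dx Dy; apply: le_trans (grad_lip Dx Dy).
    by have := enorm_coord (grad f x - grad f y) j; rewrite !mxE.
  - by move=> l; exact: observed_measurable (Obs_iterate t l ik).
  - by move=> w [r c]; apply: visits_iterate; exact: reaches_curved.
by apply: measurable_funTS; exact: observed_measurable (Obs_direction t j ik).
Qed.

(** * Drift and excess of the objective *)

Let a : R := 2 * eH ^+ 3 / (9 * M ^+ 2).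
Let b : R := 8 * eH * eg / (3 * M).

Let a0 : 0 < a. Proof. by rewrite divr_gt0// mulr_gt0// exprn_gt0. Qed.
Let b0 : 0 < b. Proof. by rewrite divr_gt0// mulr_gt0// mulr_gt0. Qed.

(* Half of the guaranteed decrease [a] of a curvature step is kept in the drift,
   the other half pays for the fluctuation in the exponential moment. *)
Definition increment (sigma : R) k w : R :=
  2 * eH / M * sigma * slope k w - a / 2.

(** Extension by zero lets one sum over all steps collect exactly the curvature steps. *)
Definition excess k : T -> R :=
  (fun w => increment (coin t k w) k w) \_ (curvature_event k).

Definition total_excess k w : R := \sum_(i < k) excess i w.

(** With a fixed sign in place of the coin, the increment is known before the coin is drawn, as
    independence requires. *)
Lemma increment_measurable sigma i k : (i <= k)%N ->
  known_fun k setT (increment sigma i \_ (curvature_event i)).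
Proof.
move=> ik; apply/(measurable_restrictT _ (curvature_event_measurable ik)).
apply: measurable_funB => //; apply: measurable_funM => //.
exact: slope_measurable.
Qed.

Lemma total_excess_measurable k :
  known_fun k setT (total_excess k).
Proof.
apply: measurable_sum => i; have ik := ltnW (ltn_ord i).
apply/(measurable_restrictT _ (curvature_event_measurable ik)).
apply: measurable_funB => //.
apply: measurable_funM; last exact: slope_measurable.
apply: measurable_funM => //; apply: measurable_funTS.
exact: observed_measurable (Obs_coin t (ltn_ord i)).
Qed.

Definition decrease : R := Num.min (eg ^+ 2 / (6 * L)) (a / 2).

Lemma reaches_decrease k w : reached k w ->
  f (iterate t k w) <= f x0 - k%:R * decrease + total_excess k w.
Proof.
elim: k => [_|k IH /reachesS[r ns]].
  by rewrite (run_start run) mul0r subr0 /total_excess big_ord0 addr0.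
have := IH r; rewrite /total_excess big_ord_recr/= -/(total_excess k w).
have : decrease <= eg ^+ 2 / (6 * L) by rewrite ge_min lexx.
have : decrease <= a / 2 by rewrite ge_min lexx orbT.
rewrite -[k.+1%:R]natr1; have [gs|gs] := ltP eg (enorm (grad_oracle t k w)).
  have := gradient_step_decrease r gs; rewrite /excess restrict_notin.
    by move: (f _) (f _) (total_excess _ _) (eg ^+ 2 / _)=> *; lra.
  by move=> [_ []]; rewrite leNgt gs.
have cs : curved k w.
  by split=> //; rewrite ltNge; apply/negP => ge; apply: ns; split.
have := curvature_step_decrease r cs; rewrite /excess patchE mem_set//.
rewrite /increment -/a.
by move: (f _) (f _) (total_excess _ _) (_ * slope _ _) => *; lra.
Qed.

Lemma normr_slope_step_le k w : curvature_event k w ->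
  `|2 * eH / M * slope k w| <= b.
Proof.
move=> [r c]; have e0 : 0 < 2 * eH / M by rewrite divr_gt0// mulr_gt0.
rewrite normrM gtr0_norm//.
have := ler_wpM2l (ltW e0) (normr_slope_le r c) => /le_trans; apply.
rewrite le_eqVlt; apply/orP; left; apply/eqP.
by rewrite /b; field; exact: lt0r_neq0.
Qed.

(** Chosen so that 2 theta^2 b^2 = theta a / 2: the quadratic term from the cosh bound is paid by
    the withheld half of [a]. *)
Let theta : R := a / (4 * b ^+ 2).

Let theta0 : 0 < theta.
Proof. by rewrite divr_gt0// mulr_gt0// exprn_gt0. Qed.

Lemma expR_increment_le k w : a / 2 < b ->
  expR (theta * (increment 1 k \_ (curvature_event k)) w)
  + expR (theta * (increment (- 1) k \_ (curvature_event k)) w) <= 2.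
Proof.
move=> ab; have [|Cw] := pselect (curvature_event k w); last first.
  by rewrite !restrict_notin// mulr0 expR0; lra.
move=> Cw; rewrite !patchE mem_set//; move: Cw => /normr_slope_step_le.
rewrite /increment !(mulr1, mulrN1, mulNr).
set y := 2 * eH / M * slope k w => yb.
rewrite !mulrBr !expRD -mulrDl mulrN.
(* theta b = a / (4 b), and a < 2 b: this brings theta y into the range of [cosh_le]. *)
have thetab : theta * b <= 2^-1.
  rewrite /theta -mulrA (_ : (4 * b ^+ 2)^-1 * b = (4 * b)^-1); last first.
    by field; exact: lt0r_neq0.
  have b4 : 0 < 4 * b by apply: mulr_gt0 => //; exact: b0.
  by rewrite ler_pdivrMr//; move: ab; move: (a) (b) => u v; lra.
have ty : `|theta * y| <= 2^-1.
  by rewrite normrM gtr0_norm// (le_trans _ thetab)// ler_pM2l.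
apply: le_trans (ler_wpM2r (expR_ge0 _) (cosh_le ty)) _.
rewrite -mulrA -expRD -[leRHS]mulr1 ler_pM2l// -[leRHS]expR0 ler_expR.
have yb2 : y ^+ 2 <= b ^+ 2.
  by rewrite -real_normK ?num_real// ler_sqr ?nnegrE ?(ltW b0).
have -> : 2 * (theta * y) ^+ 2 - theta * (a / 2)
    = 2 * theta ^+ 2 * (y ^+ 2 - b ^+ 2).
  by rewrite /theta; field; exact: lt0r_neq0.
by rewrite mulr_ge0_le0 ?subr_le0// mulr_ge0// sqr_ge0.
Qed.

(** * Exponential supermartingale and tail bound *)

Local Open Scope ereal_scope.

Lemma integral_coin_split (V : T -> \bar R) k :
  measurable_fun setT V -> (forall w, 0 <= V w) ->
  \int[P]_w V w = \int[P]_(w in coin t k @^-1` [set 1%R]) V w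
    + \int[P]_(w in coin t k @^-1` [set (-1)%R]) V w.
Proof.
move=> mV V0.
have mcoin (B : set R) : measurable B -> measurable (coin t k @^-1` B).
  move=> mB; rewrite -[X in measurable X]setTI.
  by apply: (run_measurable run (Obs_coin t (ltnSn k))).
rewrite -ge0_integral_setU//; try exact: mcoin.
- congr integral; apply/seteqP; split=> w _ //=.
  exact: (run_coin_values run).
- exact: measurable_funTS.
- rewrite disj_set2E; apply/eqP/seteqP; split=> // w [/= -> ].
  by move=> /esym/eqP; rewrite eqNr oner_eq0.
Qed.

Lemma integral_coin_half (sigma : R) k (V : T -> \bar R) :
  (sigma = 1 \/ sigma = -1)%R ->
  known_fun k setT V -> (forall w, 0 <= V w) ->
  \int[P]_(w in coin t k @^-1` [set sigma]) V w = (2^-1)%:E * \int[P]_w V w.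
Proof.
move=> s1 mV V0.
have PS : P (coin t k @^-1` [set sigma]) = (2^-1)%:E.
  by case: s1 => ->; [exact: (run_coin_plus run)|exact: (run_coin_minus run)].
rewrite -PS.
apply: (@integral_independent_event _ _ _ P (history_events k)) => //.
- exact: history_measurable.
- rewrite -[X in measurable X]setTI.
  by apply: (run_measurable run (Obs_coin t (ltnSn k))).
- by move=> A hA; apply: (run_coin_independent run).
Qed.

(** Conditional expectation is replaced by splitting on the coin: on each half the coin is a
    constant s, the integrand equals the history-measurable [V s], and independence gives half its
    full integral. The average of [V 1] and [V (-1)] is at most [U]. *)
Lemma exp_moment_le1 k : (a / 2 < b)%R ->
  \int[P]_w (expR (theta * total_excess k w))%:E <= 1.
Proof.
move=> ab; elim: k => [|k IH].
  under eq_integral => w _ do rewrite /total_excess big_ord0 mulr0 expR0.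
  rewrite integral_cst//. by rewrite mul1e; exact: probability_le1.
apply: le_trans IH.
pose U w := expR (theta * total_excess k w).
pose V s w := (U w * expR (theta * (increment s k \_ (curvature_event k)) w))%R.
have mexp (d' : measure_display) (S : measurableType d') (g : S -> R) :
    measurable_fun setT g ->
    measurable_fun setT (fun w => expR (theta * g w)).
  move=> mg; apply: (measurableT_comp (@measurable_expR R)).
  exact: measurable_funM.
have mU : known_fun k setT U.
  exact: (mexp _ (hist k) _ (@total_excess_measurable k)).
have mV s : known_fun k setT (V s).
  apply: measurable_funM => //.
  exact: (mexp _ (hist k) _ (@increment_measurable s k k (leqnn k))).
rewrite (@integral_coin_split _ k)//; last first.
  apply/measurable_EFinP; apply: (@history_measurable_fun k.+1).
  exact: (mexp _ (hist k.+1) _ (@total_excess_measurable k.+1)).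
have half s : (s = 1 \/ s = -1)%R ->
    \int[P]_(w in coin t k @^-1` [set s])
      (expR (theta * total_excess k.+1 w))%:E =
    (2^-1)%:E * \int[P]_w (V s w)%:E.
  move=> s1; rewrite -(@integral_coin_half s k (EFin \o V s))//.
  - apply: eq_integral => w; rewrite inE /= => cw.
    rewrite /V /U -expRD -mulrDr /total_excess big_ord_recr/=.
    congr (expR (_ * (_ + _)))%:E.
    by rewrite /excess !patchE cw.
  - exact/measurable_EFinP.
  - by move=> w; rewrite lee_fin mulr_ge0 ?expR_ge0.
rewrite half; last by left.
rewrite half; last by right.
have mVT s : measurable_fun setT (EFin \o (V s : T -> R)).
  by apply/measurable_EFinP; exact: (@history_measurable_fun k).
have V0 s w : 0 <= (V s w)%:E by rewrite lee_fin mulr_ge0 ?expR_ge0.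
rewrite -ge0_muleDr ?integral_ge0//.
rewrite -ge0_integralD//; try exact: mVT.
rewrite -ge0_integralZl//; last 2 first.
- by apply: emeasurable_funD; exact: mVT.
- by move=> w _; rewrite adde_ge0.
apply: ge0_le_integral => //.
- by move=> w _; rewrite mule_ge0// ?adde_ge0// lee_fin.
- by apply: measurable_funeM; apply: emeasurable_funD; exact: mVT.
- by apply/measurable_EFinP; exact: (@history_measurable_fun k).
move=> w _; rewrite -EFinD -EFinM lee_fin /V -mulrDr mulrCA.
rewrite -[leRHS]mulr1 ler_pM2l ?expR_gt0//.
have := expR_increment_le k w ab; lra.
Qed.

(** Taking N steps while f stays above fbar forces the total excess to be at least N * decrease - (f
    x0 - fbar); Markov's inequality applies to its exponential. *)
Lemma probability_reaches_le (fbar : R) N : (forall x, fbar <= f x)%R ->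
  (a / 2 < b)%R ->
  P [set w | reached N w] <=
    (expR (- (theta * (N%:R * decrease - (f x0 - fbar)))))%:E.
Proof.
move=> fge ab; set m := (theta * _)%R.
have mN : measurable [set w | reached N w].
  by apply: (@history_measurable N); apply: reaches_measurable; exact: leqW.
have mE : measurable_fun setT (fun w => (expR (theta * total_excess N w))%:E).
  apply/measurable_EFinP; apply: (@history_measurable_fun N).
  apply: (measurableT_comp (@measurable_expR R)).
  by apply: measurable_funM => //; exact: total_excess_measurable.
rewrite expRN -[leRHS]mule1 lee_pdivlMl ?expR_gt0// -integral_cst//.
apply: le_trans (exp_moment_le1 N ab).
apply: (@le_trans _ _ (\int[P]_(w in [set w | reached N w])
    (expR (theta * total_excess N w))%:E)).
  apply: ge0_le_integral => //.
  - by move=> w _; rewrite lee_fin expR_ge0.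
  - exact: measurable_funTS.
  move=> w /= rw; rewrite lee_fin ler_expR /m ler_pM2l//.
  by have := reaches_decrease rw; have := fge (iterate t N w); lra.
by apply: ge0_subset_integral => // w _; rewrite lee_fin expR_ge0.
Qed.

(** Here every increment is at most b - a / 2 <= 0, whatever the coin. *)
Lemma reaches_bound (fbar : R) N w : (forall x, fbar <= f x)%R ->
  (b <= a / 2)%R -> reached N w -> (N%:R * decrease <= f x0 - fbar)%R.
Proof.
move=> fge ba rw.
suff : (total_excess N w <= 0)%R.
  by have := reaches_decrease rw; have := fge (iterate t N w); lra.
apply: sumr_le0 => i _.
have [Cw|Cw] := pselect (curvature_event i w); last first.
  by rewrite /excess restrict_notin.
rewrite /excess patchE mem_set//; move: Cw => /normr_slope_step_le.
rewrite ler_norml /increment => /andP[].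
have [->|->] := run_coin_values run i w; move: ba;
  rewrite ?mulrN1 ?mulr1 ?mulNr; move: (_ * slope _ _)%R => *; lra.
Qed.

(** A natural k satisfies k <= n iff k <= [truncn n], so failure means no stop at steps 0 to
    [truncn n], that is, reaching the next one. *)
Lemma terminates_withinE (n : R) : (0 <= n)%R ->
  terminates_within eg eH t n = ~` [set w | reached (Num.truncn n).+1 w].
Proof.
move=> n0; have /andP[tn nt] := Num.Theory.truncn_itv n0.
apply/seteqP; split=> [w [k [kn [_ s]]] r|w /= nr].
  by apply: (r k _ s); rewrite -(ltr_nat R) (le_lt_trans kn).
have ex : exists j, (j <= Num.truncn n)%N && `[< stops eg eH t j w >].
  apply: contrapT => no; apply: nr => j jn s; apply: no; exists j.
  by rewrite -ltnS jn; apply/asboolP.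
(* [terminates_at] requires the first stopping index, hence the minimum. *)
exists (ex_minn ex); case: ex_minnP => k /andP[kn /asboolP s] mink.
split; first by rewrite (le_trans _ tn)// ler_nat.
split=> // j jk sj; have := mink j.
rewrite (leq_trans (ltnW jk) kn)/= leqNgt jk.
by move=> /(_ (introT (asboolP _) sj)).
Qed.

(** * The two terms of the iteration bound *)

Local Open Scope ring_scope.

Let decrease0 : 0 < decrease.
Proof.
by rewrite lt_min !divr_gt0// ?exprn_gt0// ?mulr_gt0//; exact: a0.
Qed.

(** Each argument of the maximum times its counterpart in the minimum [decrease] equals 1/3, and 6/3
    = 2. *)
Lemma first_term_ge (gap : R) : 0 <= gap -> 2 * gap <=
  6 * gap * Num.max (2 * L / eg ^+ 2) (3 * M ^+ 2 / eH ^+ 3) * decrease.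
Proof.
move=> gap0; set m := Num.max _ _.
suff : 3^-1 <= m * decrease.
  by move=> /(ler_wpM2l gap0); move: (decrease) => u; lra.
rewrite /decrease; case: (leP (eg ^+ 2 / (6 * L)) (a / 2)) => _.
  rewrite (_ : 3^-1 = (2 * L / eg ^+ 2) * (eg ^+ 2 / (6 * L))).
    by rewrite ler_wpM2r ?le_max ?lexx// divr_ge0 ?sqr_ge0// mulr_ge0// ltW.
  by field; rewrite !lt0r_neq0.
rewrite (_ : 3^-1 = (3 * M ^+ 2 / eH ^+ 3) * (a / 2)).
  by rewrite ler_wpM2r ?le_max ?lexx ?orbT// divr_ge0// ltW// a0.
by rewrite /a; field; rewrite !lt0r_neq0.
Qed.

(* The constant is 128 * (6 * 24): 1 / theta = 128 eg^2 / eH, 1 / decrease is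
   6 L / eg^2 or 9 M^2 / eH^3, and [a / 2 < b] means eH^2 < 24 M eg. *)
Lemma last_term_ge (Lambda : R) : 0 <= Lambda -> a / 2 < b ->
  Lambda <= theta * (128 * 144 * Lambda *
    (Num.max (L * eH) (M * eg) * (M * eg) / eH ^+ 4) * decrease).
Proof.
move=> La0 ab; set m := Num.max _ _.
suff : 1 <= theta * (128 * 144) * (m * (M * eg) / eH ^+ 4) * decrease.
  move=> /(ler_wpM2l La0); rewrite mulr1 => /le_trans; apply.
  by rewrite le_eqVlt; apply/orP; left; apply/eqP; ring.
have eg2 : eH ^+ 2 < 24 * (M * eg).
  have e0 : 0 < 9 * M ^+ 2 / eH by rewrite divr_gt0// mulr_gt0// exprn_gt0.
  move: ab; rewrite -(ltr_pM2r e0).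
  rewrite /a /b (_ : _ / 2 * (9 * M ^+ 2 / eH) = eH ^+ 2); last first.
    by field; rewrite !lt0r_neq0.
  rewrite (_ : _ * (9 * M ^+ 2 / eH) = 24 * (M * eg))//.
  by field; rewrite !lt0r_neq0.
have thetaE : theta = eH / (128 * eg ^+ 2).
  by rewrite /theta /a /b; field; rewrite !lt0r_neq0.
have w0 : 0 <= M * eg / eH ^+ 4 by rewrite divr_ge0 ?mulr_ge0 ?exprn_ge0 ?ltW.
have t0 : 0 <= theta * (128 * 144).
  by apply: mulr_ge0; [exact: ltW theta0|exact: mulr_ge0].
have mono u : u <= m ->
    theta * (128 * 144) * (u * (M * eg) / eH ^+ 4) * decrease <=
    theta * (128 * 144) * (m * (M * eg) / eH ^+ 4) * decrease.
  move=> um; rewrite ler_wpM2r ?(ltW decrease0)// ler_wpM2l//.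
  by rewrite -!mulrA ler_wpM2r// mulrA.
move: mono; rewrite /decrease.
(* Keep the argument of the maximum that matches the smaller drift: the product becomes 24 M eg /
   eH^2 > 1 by [eg2] in one case and 16 in the other. *)
case: (leP (eg ^+ 2 / (6 * L)) (a / 2)) => _ mono.
  apply: le_trans (mono (L * eH) _); last by rewrite le_max lexx.
  rewrite thetaE (_ : _ * _ = 24 * (M * eg) / eH ^+ 2).
    by rewrite ler_pdivlMr ?exprn_gt0// mul1r ltW.
  by field; rewrite !lt0r_neq0.
apply: le_trans (mono (M * eg) _); last by rewrite le_max lexx orbT.
rewrite thetaE (_ : _ * _ = 16); first by rewrite ler1n.
by rewrite /a; field; rewrite !lt0r_neq0.
Qed.

Lemma terminates_within_probability (fbar delta Lambda : R) :
  (forall x, fbar <= f x) -> 0 < delta -> 1 <= Lambda ->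
  ln (1 / delta) <= Lambda ->
  ((1 - delta)%:E <= P (terminates_within eg eH t
    (6 * (f x0 - fbar) * Num.max (2 * L / eg ^+ 2) (3 * M ^+ 2 / eH ^+ 3)
     + 128 * 144 * Lambda *
         (Num.max (L * eH) (M * eg) * (M * eg) / eH ^+ 4))%R))%E.
Proof.
move=> fge delta0 La1 lnLa; have La0 : 0 <= Lambda by rewrite (le_trans ler01).
have gap0 : 0 <= f x0 - fbar by rewrite subr_ge0.
have := first_term_ge gap0; have := last_term_ge La0.
set first_term := _ * Num.max _ _.
set last_term := 128 * 144 * _ * _ => last_ge first_ge.
have last0 : 0 <= last_term.
  have Meg0 : 0 <= M * eg by rewrite mulr_ge0 ?ltW.
  apply: mulr_ge0; first exact: mulr_ge0.
  apply: divr_ge0; last by rewrite exprn_ge0// ltW.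
  by apply: mulr_ge0; rewrite // le_max Meg0 orbT.
have first0 : 0 <= first_term.
  apply: mulr_ge0; first exact: mulr_ge0.
  by rewrite le_max divr_ge0 ?sqr_ge0// mulr_ge0// ltW.
have n0 := addr_ge0 first0 last0.
rewrite (terminates_withinE n0); set N := (Num.truncn _).+1.
have nN : first_term + last_term < N%:R by exact: Num.Theory.truncnS_gt.
have mN : measurable [set w | reached N w].
  by apply: (@history_measurable N); apply: reaches_measurable; exact: leqW.
rewrite probability_setC// EFinB leeB//.
have Nge : (first_term + last_term) * decrease < N%:R * decrease.
  by rewrite ltr_pM2r// decrease0.
have [ab|ba] := ltP (a / 2) b.
  apply: le_trans (probability_reaches_le N fge ab) _.
  (* [first_ge] covers the gap subtracted in the exponent, which leaves theta * last_term * decrease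
     >= Lambda >= ln (1 / delta). *)
  rewrite lee_fin -[leRHS]lnK ?posrE// ler_expR lerNl -lnV ?posrE//.
  rewrite -[delta^-1]mul1r (le_trans lnLa)// (le_trans (last_ge ab))//.
  rewrite ler_pM2l; last exact: theta0.
  by move: Nge first_ge; rewrite mulrDl; lra.
rewrite (_ : [set w | _] = set0) ?measure0 ?lee_fin ?ltW//.
apply/seteqP; split=> // w /= r.
have := reaches_bound fge ba r; move: Nge first_ge.
have := mulr_ge0 last0 (ltW decrease0).
by rewrite mulrDl; lra.
Qed.

End Run.

(** * The iteration bound with explicit constants *)

Theorem corollary2p12 (R : realType) :
  exists (c : R) (K : R -> R -> R -> R),
  0 < c /\
  forall (d : nat) (f : 'rV[R]_d -> R) (L M fbar eg eH delta : R)
    (x0 : 'rV[R]_d) (D : set 'rV[R]_d)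
    (disp : measure_display) (T : measurableType disp) (P : probability T R)
    (t : trajectory R d T),
  0 < eg -> 0 < eH -> 0 < L -> 0 < M -> 0 < delta < 1 ->
  (forall x, fbar <= f x) ->
  (forall x, D x -> twice_differentiable f x) ->
  gradient_lipschitz_on D L f ->
  hessian_lipschitz_on D M f ->
  visits_only eg eH t D ->
  algorithm_run P eg eH L M eH t x0 ->
  (forall k w, reaches eg eH t k w -> takes_curvature_step eg eH t k w ->
     stepsize t k w = eH) ->
  accurate_oracles eg eH t f ->
  let Lambda := log_factor eg eH L M eH (f x0 - fbar) delta in
  let first_term :=
    6 * (f x0 - fbar)
      * Num.max (2 * L / eg ^+ 2) (3 * M ^+ 2 / eH ^+ 3) in
  let last_term :=
    c * Lambda * (Num.max (L * eH) (M * eg) * (M * eg) / eH ^+ 4) in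
  ((1 - delta)%:E <= P (terminates_within eg eH t (first_term + last_term)))%E
  /\ (fbar < f x0 -> M * eg < L * eH ->
      last_term <= K L M (f x0 - fbar) * Lambda * first_term).
Proof.
(* [K] comes from first_term >= 18 gap M^2 / eH^3 and, with M eg < L eH and eH <= L, from last_term
   <= 128 * 144 * Lambda * L^3 / eH^3. *)
exists (128 * 144), (fun L M gap => 128 * 144 * L ^+ 3 / (18 * gap * M ^+ 2)).
split=> // d f L M fbar eg eH delta x0 D disp T P t eg0 eH0 L0 M0.
move=> /andP[delta0 delta1] fge f_smooth grad_lip hess_lip visits run.
move=> step_eH acc Lambda first_term last_term.
have La1 : 1 <= Lambda by rewrite !le_max lexx !orbT.
split.
  apply: (terminates_within_probability eg0 eH0 L0 M0 f_smooth grad_lip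
    hess_lip visits run step_eH acc) => //.
  by rewrite le_max lexx.
rewrite -subr_gt0 => gap0 egH.
have eHL : eH <= L by case/andP: (run_alpha run).
have La0 : 0 <= Lambda by rewrite (le_trans ler01).
rewrite /last_term /first_term max_l ?(ltW egH)//.
set gap := f x0 - fbar in gap0 *.
set m := Num.max _ _.
have m_ge : 3 * M ^+ 2 / eH ^+ 3 <= m by rewrite le_max lexx orbT.
have c0 : 0 <= 128 * 144 * L ^+ 3 / (18 * gap * M ^+ 2) * Lambda * (6 * gap).
  by rewrite !mulr_ge0// ?invr_ge0 ?mulr_ge0 ?exprn_ge0 ?ltW.
rewrite [leRHS]mulrA; apply: le_trans (ler_wpM2l c0 m_ge).
rewrite [leRHS](_ : _ = 128 * 144 * Lambda * (L ^+ 3 / eH ^+ 3)); last first.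
  by field; rewrite !lt0r_neq0.
rewrite ler_wpM2l ?mulr_ge0//.
rewrite (_ : L * eH * (M * eg) / eH ^+ 4 = L * (M * eg) / eH ^+ 3); last first.
  by field; rewrite lt0r_neq0.
rewrite ler_pM2r ?invr_gt0 ?exprn_gt0// exprS ler_pM2l//.
by rewrite (le_trans (ltW egH))// expr2 ler_pM2l.
Qed.
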